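(* Let $\beta>1$, let $\lambda\in\mathbb{C}$ be an isolated eigenvalue of the Perron-Frobenius operator $\mathcal{L}_\beta$ with $|\lambda|>1/\beta$, and let $\nu\in\widehat{BV}^*$ be an eigenfunctional corresponding to $\lambda$. Then for every $x\in[0,1]$, $$\nu(\mathbf{1}_{[0,x]})=\nu(\mathbf{1}_{[0,1]})\sum_{n=1}^\infty\frac{a_n(\beta,x)}{\beta^n\lambda^n}.$$ In addition, $\nu(\mathbf{1}_{[0,1]})\ne0$.
   Context: For real $\beta>1$, the beta-map is $\tau_\beta:[0,1]\to[0,1]$, $\tau_\beta(x)=\beta x-[\beta x]$, where $[y]$ is the integer part of $y\ge 0$; $\tau_\beta^0(x)=x$. For $x\in[0,1]$ and $n\ge1$ put $a_n(\beta,x)=[\beta\tau_\beta^{n-1}(x)]$. $\mathbf{1}_A$ is the indicator function of $A$. Let $BV$ be the Banach space of functions $f:[0,1]\to\mathbb{C}$ of bounded variation with norm $\|f\|_{BV}=\operatorname{var}(f)+\sup_{x\in[0,1]}|f(x)|$, let $\mathcal{N}\subset BV$ be the closed subspace of those $f\in BV$ that vanish outside some countable set, and let $\widehat{BV}=BV/\mathcal{N}$ with the quotient norm. The Perron-Frobenius operator $\mathcal{L}_\beta f(x)=\frac1\beta\sum_{y\in[0,1],\,\tau_\beta(y)=x}f(y)$ is considered as a bounded operator on $\widehat{BV}$. Every spectral value $\lambda$ of $\mathcal{L}_\beta$ with $|\lambda|>1/\beta$ is an isolated eigenvalue of finite multiplicity and satisfies $|\lambda|\le 1$. $\widehat{BV}^*$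 is the space of bounded complex-valued linear functionals on $\widehat{BV}$, and the dual operator is $(\mathcal{L}_\beta^*\nu)(f)=\nu(\mathcal{L}_\beta f)$. An eigenfunctional corresponding to $\lambda$ is a nonzero $\nu\in\widehat{BV}^*$ with $\mathcal{L}_\beta^*\nu=\lambda\nu$. *)

(* Defs.v *)
From HB Require Import structures.
From mathcomp Require Import all_boot all_order all_algebra.
From mathcomp Require Import generic_quotient ring_quotient complex.
From mathcomp Require Import all_classical all_reals all_analysis.
Set Implicit Arguments.
Unset Strict Implicit.
Unset Printing Implicit Defensive.
Import Order.TTheory GRing.Theory Num.Theory.
Import numFieldNormedType.Exports.
Import ComplexField.Normc.
Local Open Scope classical_set_scope.
Local Open Scope ring_scope.

Section Modulus.
Context {R : realType}.
Implicit Types z w : R[i].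

Lemma norm_normc z : `|z| = ((normc z)%:C)%C.
Proof. by []. Qed.

Lemma normc_ge0 z : 0 <= normc z.
Proof. by rewrite -lecR -norm_normc normr_ge0. Qed.

Lemma le_normc_add z w : normc (z + w) <= normc z + normc w.
Proof. by rewrite -lecR rmorphD/= -!norm_normc ler_normD. Qed.

Lemma normc_real (x : R) : normc (x%:C)%C = `|x|.
Proof. by rewrite /= expr0n/= addr0 sqrtr_sqr. Qed.

End Modulus.

(* The library's total variation is for functions R -> R; here the functions
   are complex-valued with domain exactly [0, 1], the type {i01 R}.  [normc] is
   the modulus as a number of R (so that suprema make sense), whereas `|z| is
   the same number seen in R[i].  The points of a partition may repeat: this
   only adds zero terms. *)
Section BoundedVariation.
Context {R : realType}.
Implicit Types (f g : {i01 R} -> R[i]) (s : seq {i01 R}).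

Definition variation01 f s : R :=
  \sum_(0 <= j < (size s).-1)
    normc (f (nth 0%:i01 s j.+1) - f (nth 0%:i01 s j)).

Definition variations01 f : set R :=
  [set variation01 f s | s in [set s | sorted <=%O s]].

Definition bounded_variation01 f := has_ubound (variations01 f).

(* As for every [sup] over R, the value is meaningful only if the set is
   bounded, i.e. for f of bounded variation; same remark for [sup_norm]. *)
Definition total_variation01 f : R := sup (variations01 f).

Definition sup_norm f : R := sup (range (fun x => normc (f x))).

Definition bv_norm f : R := total_variation01 f + sup_norm f.

Lemma variation01_ge0 f s : 0 <= variation01 f s.
Proof. by apply: sumr_ge0 => j _; exact: normc_ge0. Qed.

Lemma variations01_neq0 f : variations01 f !=set0.
Proof. by exists (variation01 f [::]); exists [::]. Qed.

Lemma bounded_variation01P f :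
  bounded_variation01 f <->
  exists M, forall s, sorted <=%O s -> variation01 f s <= M.
Proof.
split=> [[M fM]|[M fM]]; exists M; first by move=> s ss; apply: fM; exists s.
by move=> _ [s /= ss <-]; exact: fM.
Qed.

Lemma le_total_variation01 f s : bounded_variation01 f -> sorted <=%O s ->
  variation01 f s <= total_variation01 f.
Proof. by move=> bf ss; apply: ub_le_sup => //; exists s. Qed.

Lemma total_variation01_le f M :
  (forall s, sorted <=%O s -> variation01 f s <= M) ->
  total_variation01 f <= M.
Proof.
move=> fM; apply: ge_sup; first exact: variations01_neq0.
by move=> _ [s /= ss <-]; exact: fM.
Qed.

Lemma total_variation01_ge0 f : bounded_variation01 f ->
  0 <= total_variation01 f.
Proof.
move=> bf; apply: le_trans (le_total_variation01 (s := [::]) bf _) => //.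
exact: variation01_ge0.
Qed.

Lemma bounded_variation01_bounded f : bounded_variation01 f ->
  exists M, forall x, normc (f x) <= M.
Proof.
move=> bf; exists (total_variation01 f + normc (f 0%:i01)) => x.
have ss : sorted <=%O [:: 0%:i01; x].
  by rewrite /= andbT -num_le; apply: ge0.
have := le_total_variation01 bf ss.
rewrite /variation01/= big_nat1/= => fx.
rewrite -[f x](subrK (f 0%:i01)); apply: le_trans (le_normc_add _ _) _.
by rewrite lerD2r.
Qed.

Lemma le_sup_norm f x : bounded_variation01 f -> normc (f x) <= sup_norm f.
Proof.
move=> /bounded_variation01_bounded[M fM]; apply: ub_le_sup; last by exists x.
by exists M => _ [y _ <-]; exact: fM.
Qed.

Lemma sup_norm_le f M : (forall x, normc (f x) <= M) -> sup_norm f <= M.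
Proof.
move=> fM; apply: ge_sup; first by exists (normc (f 0%:i01)), 0%:i01.
by move=> _ [x _ <-]; exact: fM.
Qed.

Lemma sup_norm_ge0 f : bounded_variation01 f -> 0 <= sup_norm f.
Proof. by move=> bf; apply: le_trans (le_sup_norm 0%:i01 bf); exact: normc_ge0. Qed.

Lemma bv_norm_ge0 f : bounded_variation01 f -> 0 <= bv_norm f.
Proof.
by move=> bf; rewrite addr_ge0 ?total_variation01_ge0 ?sup_norm_ge0.
Qed.

Lemma variation01D f g s :
  variation01 (f + g) s <= variation01 f s + variation01 g s.
Proof.
rewrite -big_split/=; apply: ler_sum => j _.
by rewrite opprD addrACA; exact: le_normc_add.
Qed.

Lemma variation01Z (a : R[i]) f s :
  variation01 (a *: f) s = normc a * variation01 f s.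
Proof.
rewrite /variation01 mulr_sumr; apply: eq_bigr => j _.
by rewrite -normcM mulrBr.
Qed.

Lemma bounded_variation01_0 : bounded_variation01 0.
Proof.
apply/bounded_variation01P; exists 0 => s _; rewrite /variation01 big1// => j _.
by rewrite subrr normc0.
Qed.

Lemma bounded_variation01D f g : bounded_variation01 f ->
  bounded_variation01 g -> bounded_variation01 (f + g).
Proof.
move=> /bounded_variation01P[M fM] /bounded_variation01P[N gN].
apply/bounded_variation01P; exists (M + N) => s ss.
by apply: le_trans (variation01D _ _ _) _; rewrite lerD ?fM ?gN.
Qed.

Lemma bounded_variation01Z (a : R[i]) f : bounded_variation01 f ->
  bounded_variation01 (a *: f).
Proof.
move=> /bounded_variation01P[M fM]; apply/bounded_variation01P.
exists (normc a * M) => s ss; rewrite variation01Z.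
by rewrite ler_wpM2l ?normc_ge0 ?fM.
Qed.

Lemma variation01M f g A B s :
  (forall x, normc (f x) <= A) -> (forall x, normc (g x) <= B) ->
  variation01 (fun x => f x * g x) s <= A * variation01 g s + B * variation01 f s.
Proof.
move=> fA gB; rewrite /variation01 !mulr_sumr -big_split/=; apply: ler_sum => j _.
set x := nth _ s j.+1; set y := nth _ s j.
have -> : f x * g x - f y * g y = f x * (g x - g y) + g y * (f x - f y).
  by rewrite !mulrBr addrA [g y * f x]mulrC subrK [g y * _]mulrC.
apply: le_trans (le_normc_add _ _) _; rewrite !normcM.
by rewrite lerD// ler_wpM2r ?normc_ge0.
Qed.

Lemma variation01_comp f (p : {i01 R} -> {i01 R}) s :
  variation01 (f \o p) s = variation01 f (map p s).
Proof.
rewrite /variation01 size_map; apply: eq_big_nat => j /andP[_ js].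
have js1 : (j.+1 < size s)%N by case: (s) js.
by rewrite !(nth_map 0%:i01)//; exact: ltnW.
Qed.

Lemma variation01_lower (D : set {i01 R}) s :
  (forall x y, (x <= y)%O -> D y -> D x) -> sorted <=%O s ->
  variation01 (\1_D : {i01 R} -> R[i]) s <= 1.
Proof.
move=> Dl ss.
pose h x : R := \1_D x.
have h0 x : 0 <= h x by rewrite /h indicE; case: (x \in D).
have h1 x : h x <= 1 by rewrite /h indicE; case: (x \in D).
have hle x y : (x <= y)%O -> h y <= h x.
  move=> xy; rewrite /h !indicE.
  have [/set_mem/(Dl _ _ xy)/mem_set->//|_] := boolP (y \in D).
  by case: (x \in D).
rewrite (_ : variation01 _ _ = \sum_(0 <= j < (size s).-1)
    ((- h (nth 0%:i01 s j.+1)) - (- h (nth 0%:i01 s j)))).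
  rewrite telescope_sumr// opprK.
  by rewrite addrC lerBlDr (le_trans (h1 _))// lerDl h0.
apply: eq_big_nat => j /andP[_ js].
have js1 : (j.+1 < size s)%N by case: (s) js.
have hc x : (\1_D x : R[i]) = ((h x)%:C)%C.
  by rewrite /h !indicE; case: (x \in D).
rewrite !hc -rmorphB normc_real distrC opprK ger0_norm; first by rewrite addrC.
rewrite subr_ge0.
apply: hle; apply: (sorted_leq_nth le_trans le_refl) => //.
exact: ltnW.
Qed.


Lemma bounded_variation01_lower (D : set {i01 R}) :
  (forall x y, (x <= y)%O -> D y -> D x) ->
  bounded_variation01 (\1_D : {i01 R} -> R[i]).
Proof.
by move=> Dl; apply/bounded_variation01P; exists 1 => s; exact: variation01_lower.
Qed.

Lemma variation01_lower_comp (D : set {i01 R}) f (p : {i01 R} -> {i01 R}) s :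
  (forall x y, (x <= y)%O -> D y -> D x) -> {homo p : x y / (x <= y)%O} ->
  bounded_variation01 f -> sorted <=%O s ->
  variation01 (fun x => \1_D x * f (p x)) s <= bv_norm f.
Proof.
move=> Dl pm bf ss.
apply: le_trans (@variation01M _ _ 1 (sup_norm f) s _ _) _.
- by move=> x; rewrite indicE; case: (x \in D); rewrite ?normc1 ?normc0.
- by move=> x; exact: le_sup_norm.
rewrite mul1r lerD//.
  rewrite -/(variation01 (f \o p) s) variation01_comp le_total_variation01//.
  by rewrite sorted_map; apply: sub_sorted ss => x y; exact: pm.
by rewrite ler_piMr ?sup_norm_ge0// variation01_lower.
Qed.

End BoundedVariation.

Section BVSpace.
Context (R : realType).

Definition bv_pred : {pred {i01 R} -> R[i]} :=
  [pred f | `[< bounded_variation01 f >]].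

Record BV := MkBV { bv_fun :> {i01 R} -> R[i]; bv_funP : bv_fun \in bv_pred }.

HB.instance Definition _ := [isSub for bv_fun].
HB.instance Definition _ := [Choice of BV by <:].

Lemma bv_pred_closed : submod_closed bv_pred.
Proof.
split; first by apply/asboolP; exact: bounded_variation01_0.
move=> a f g /asboolP bf /asboolP bg; apply/asboolP.
by apply: bounded_variation01D => //; exact: bounded_variation01Z.
Qed.

HB.instance Definition _ := GRing.isSubmodClosed.Build R[i] _ bv_pred
  bv_pred_closed.
HB.instance Definition _ := [SubChoice_isSubLmodule of BV by <:].

Lemma BVP (f : BV) : bounded_variation01 f.
Proof. exact/asboolP/bv_funP. Qed.

Definition mkBV f (bf : bounded_variation01 f) : BV := MkBV (asboolT bf).

(* The subspace of the f in BV that vanish outside some countable set. *)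
Definition null_pred : {pred BV} := [pred f : BV | `[<
  exists2 A : set {i01 R}, countable A & forall x, ~ A x -> f x = 0 >]].

Lemma null_pred_closed : submod_closed null_pred.
Proof.
split; first by apply/asboolP; exists set0.
move=> a f g /asboolP[A cA fA] /asboolP[B cB gB]; apply/asboolP.
exists (A `|` B).
  rewrite -bigcup2E; apply: bigcup_countable => [|[|[|n]] _]//=.
move=> x /not_orP[Ax Bx]; rewrite /= -[LHS]/(a * f x + g x).
by rewrite fA// gB// mulr0 addr0.
Qed.

HB.instance Definition _ := GRing.isSubmodClosed.Build R[i] BV null_pred
  null_pred_closed.

End BVSpace.

Arguments null_pred {R}.
Arguments bv_pred {R}.

Section BVQuotient.
Context (R : realType).
Local Open Scope quotient_scope.

(* [ideal_quot] is the quotient of an additive group by an additive subgroup;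
   no ring structure is involved. *)
Definition BVhat : Type := {ideal_quot (null_pred : zmodClosed (BV R))}.

HB.instance Definition _ := GRing.Zmodule.on BVhat.

Definition toBVhat : BV R -> BVhat := \pi_(BVhat).

Lemma toBVhat_eq (f g : BV R) :
  toBVhat f = toBVhat g <-> f - g \in null_pred.
Proof.
rewrite /toBVhat; split=> [/eqP|fg]; first by rewrite -Quotient.idealrBE.
by apply/eqP; rewrite -Quotient.idealrBE.
Qed.

Lemma toBVhat_surj (u : BVhat) : exists f, toBVhat f = u.
Proof. by exists (repr u); exact: reprK. Qed.

Lemma toBVhatD (f g : BV R) : toBVhat (f + g) = toBVhat f + toBVhat g.
Proof. by rewrite /toBVhat !piE. Qed.

Definition scale_BVhat (a : R[i]) (u : BVhat) : BVhat :=
  toBVhat (a *: repr u).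

Lemma scale_toBVhat a f : scale_BVhat a (toBVhat f) = toBVhat (a *: f).
Proof.
apply/toBVhat_eq; rewrite -scalerBr rpredZ//.
by apply/toBVhat_eq; exact: reprK.
Qed.

Lemma scale_BVhatA a b u :
  scale_BVhat a (scale_BVhat b u) = scale_BVhat (a * b) u.
Proof.
by have [f <-] := toBVhat_surj u; rewrite !scale_toBVhat scalerA.
Qed.

Lemma scale_BVhat1 : left_id 1 scale_BVhat.
Proof. by move=> u; have [f <-] := toBVhat_surj u; rewrite scale_toBVhat scale1r. Qed.

Lemma scale_BVhatDr : right_distributive scale_BVhat +%R.
Proof.
move=> a u v; have [f <-] := toBVhat_surj u; have [g <-] := toBVhat_surj v.
by rewrite -toBVhatD !scale_toBVhat scalerDr toBVhatD.
Qed.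

Lemma scale_BVhatDl u : {morph scale_BVhat^~ u : a b / a + b}.
Proof.
move=> a b; have [f <-] := toBVhat_surj u.
by rewrite !scale_toBVhat scalerDl toBVhatD.
Qed.

HB.instance Definition _ := GRing.Zmodule_isLmodule.Build R[i] BVhat
  scale_BVhatA scale_BVhat1 scale_BVhatDr scale_BVhatDl.

Lemma toBVhat_linear : linear toBVhat.
Proof.
move=> a f g; rewrite toBVhatD; congr (_ + _).
by rewrite -scale_toBVhat.
Qed.

HB.instance Definition _ := GRing.isLinear.Build R[i] (BV R) BVhat _ toBVhat
  toBVhat_linear.

Definition quot_norm (u : BVhat) : R :=
  inf [set bv_norm f | f in [set f : BV R | toBVhat f = u]].

Let fiber_norm_neq0 u :
  [set bv_norm f | f in [set f : BV R | toBVhat f = u]] !=set0.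
Proof. by have [f fu] := toBVhat_surj u; exists (bv_norm f), f. Qed.

Lemma quot_norm_le (f : BV R) : quot_norm (toBVhat f) <= bv_norm f.
Proof.
apply: ge_inf; last by exists f.
by exists 0 => _ [g _ <-]; apply: bv_norm_ge0; exact: BVP.
Qed.

Lemma quot_norm_ge0 u : 0 <= quot_norm u.
Proof.
apply: lb_le_inf; first exact: fiber_norm_neq0.
by move=> _ [g _ <-]; apply: bv_norm_ge0; exact: BVP.
Qed.

Lemma quot_norm_adherent u e : 0 < e ->
  exists2 f : BV R, toBVhat f = u & bv_norm f < quot_norm u + e.
Proof.
move=> e0; have : has_inf [set bv_norm f | f in [set f : BV R | toBVhat f = u]].
  split; first exact: fiber_norm_neq0.
  by exists 0 => _ [g _ <-]; apply: bv_norm_ge0; exact: BVP.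
by move=> /(inf_adherent e0)[_ [f fu <-] fe]; exists f.
Qed.

Lemma bv_normD (f g : BV R) : bv_norm (f + g) <= bv_norm f + bv_norm g.
Proof.
rewrite /bv_norm addrACA lerD//.
  apply: total_variation01_le => s ss; apply: le_trans (variation01D _ _ _) _.
  by rewrite lerD// le_total_variation01//; exact: BVP.
apply: sup_norm_le => x; apply: le_trans (le_normc_add _ _) _.
by rewrite lerD// le_sup_norm//; exact: BVP.
Qed.

Lemma bv_normZ (a : R[i]) (f : BV R) : bv_norm (a *: f) <= normc a * bv_norm f.
Proof.
rewrite /bv_norm mulrDr lerD//.
  apply: total_variation01_le => s ss; rewrite variation01Z.
  by rewrite ler_wpM2l ?normc_ge0 ?le_total_variation01//; exact: BVP.
apply: sup_norm_le => x; rewrite normcM.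
by rewrite ler_wpM2l ?normc_ge0 ?le_sup_norm//; exact: BVP.
Qed.

Lemma quot_normD u v : quot_norm (u + v) <= quot_norm u + quot_norm v.
Proof.
apply/ler_addgt0Pr => e e0; have e20 : 0 < e / 2 by rewrite divr_gt0.
have [f <- fe] := quot_norm_adherent u e20.
have [g <- ge] := quot_norm_adherent v e20.
rewrite -linearD; apply: le_trans (quot_norm_le _) _.
apply: le_trans (bv_normD _ _) _.
by rewrite (splitr e) [leRHS]addrACA; apply/ltW/ltrD.
Qed.

Lemma quot_normZ (a : R[i]) u : quot_norm (a *: u) = normc a * quot_norm u.
Proof.
have le b v : quot_norm (b *: v) <= normc b * quot_norm v.
  apply/ler_addgt0Pr => e e0.
  have b0 : 0 < normc b + 1 by rewrite ltr_wpDl ?normc_ge0.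
  have [f <- fe] := quot_norm_adherent v (divr_gt0 e0 b0).
  rewrite -linearZ; apply: le_trans (quot_norm_le _) _.
  apply: le_trans (bv_normZ _ _) _.
  apply: (le_trans (ler_wpM2l (normc_ge0 _) (ltW fe))).
  rewrite mulrDr lerD2l mulrCA ger_pMr// ler_pdivrMr// mul1r.
  by rewrite lerDl ler01.
apply/eqP; rewrite eq_le le/=; have [->|a0] := eqVneq a 0.
  by rewrite normc0 mul0r quot_norm_ge0.
have na0 : 0 < normc a.
  rewrite lt_neqAle normc_ge0 andbT eq_sym; apply: contra a0.
  by move=> /eqP/eq0_normc ->.
rewrite -ler_pdivlMl//; have := le a^-1 (a *: u).
by rewrite scalerA mulVf// scale1r normcV.
Qed.

Lemma quot_norm_eq0 u : quot_norm u = 0 -> u = 0.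
Proof.
move=> u0; have [f fu] := toBVhat_surj u; rewrite -fu.
have fE k : exists gA : BV R * set {i01 R}, [/\ countable gA.2,
    bv_norm gA.1 < k.+1%:R^-1 & forall x, ~ gA.2 x -> f x = gA.1 x].
  have k0 : 0 < k.+1%:R^-1 :> R by rewrite invr_gt0.
  have [g gu] := quot_norm_adherent u k0; rewrite u0 add0r => gk.
  have /toBVhat_eq/asboolP[A cA fgA] : toBVhat f = toBVhat g by rewrite fu.
  exists (g, A); split=> // x /fgA /eqP.
  by rewrite -[X in X == _]/(f x - g x) subr_eq0 => /eqP.
have [gA gAP] := choice fE.
rewrite -(linear0 toBVhat); apply/toBVhat_eq; rewrite subr0; apply/asboolP.
exists (\bigcup_k (gA k).2).
  by apply: bigcup_countable => // k _; case: (gAP k).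
move=> x Ax; apply: eq0_normc; apply/eqP; rewrite eq_le normc_ge0 andbT.
apply/ler_addgt0Pr => e e0; rewrite add0r.
have [k ke] := @ltr_add_invr R 0 e e0; rewrite add0r in ke.
have [_ gk ->] := gAP k; last by move=> Akx; apply: Ax; exists k.
apply: ltW; apply: le_lt_trans ke; apply: le_trans (ltW gk).
apply: le_trans (le_sup_norm x (BVP (gA k).1)) _.
by rewrite lerDr total_variation01_ge0//; exact: BVP.
Qed.

(* A norm on an R[i]-module takes its values in R[i]. *)
Let cnorm (u : BVhat) : R[i] := ((quot_norm u)%:C)%C.

Let cnormD u v : cnorm (u + v) <= cnorm u + cnorm v.
Proof. by rewrite /cnorm -rmorphD lecR quot_normD. Qed.

Let cnormZ a u : cnorm (a *: u) = `|a| * cnorm u.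
Proof. by rewrite /cnorm quot_normZ rmorphM. Qed.

Let cnorm_eq0 u : cnorm u = 0 -> u = 0.
Proof. by move=> [/quot_norm_eq0]. Qed.

HB.instance Definition _ := Lmodule_isNormed.Build R[i] BVhat
  cnormD cnormZ cnorm_eq0.

Lemma norm_BVhatE (u : BVhat) : `|u| = ((quot_norm u)%:C)%C.
Proof. by []. Qed.

End BVQuotient.

Section Operators.
Context {K : numFieldType} {V W : normedModType K}.

Definition bounded_op (T : {linear V -> W}) :=
  exists M : K, forall x, `|T x| <= M * `|x|.

End Operators.

Section Spectrum.
Context {K : numFieldType} {V : normedModType K}.
Implicit Types (T : {linear V -> V}) (l : K).

(* l is in the resolvent set when l - T has a bounded two-sided inverse S. *)
Definition resolvent_set T : set K^o :=
  [set l | exists S : {linear V -> V}, [/\ bounded_op S,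
     forall x, S (l *: x - T x) = x & forall x, l *: S x - T (S x) = x]].

Definition spectrum T : set K^o := ~` resolvent_set T.

Definition is_eigenvalue T l := exists2 x, x != 0 & T x = l *: x.

Definition isolated_eigenvalue T l :=
  is_eigenvalue T l /\ isolated (spectrum T) l.

(* The dual of V is the set of nu : {linear V -> K^o} with [bounded_op nu]. *)
Definition dual_op T (nu : {linear V -> K^o}) : {linear V -> K^o} := nu \o T.

Definition eigenfunctional T l (nu : {linear V -> K^o}) :=
  [/\ bounded_op nu, exists x, nu x != 0 &
      forall x, dual_op T nu x = l * nu x].

End Spectrum.

Section BetaMap.
Context {R : realType}.
Implicit Types (beta : R) (x y : {i01 R}).

Let frac_ge0 (t : R) : 0 <= t - (Num.floor t)%:~R.
Proof. by rewrite subr_ge0 floor_le. Qed.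

Let frac_le1 (t : R) : t - (Num.floor t)%:~R <= 1.
Proof. by rewrite lerBlDl ltW// -(intrD R _ 1) floorD1_gt. Qed.

Definition beta_map beta x : {i01 R} :=
  Itv01 (frac_ge0 (beta * x%:num)) (frac_le1 (beta * x%:num)).

(* Meant for n >= 1: n.-1 is truncated at n = 0. *)
Definition beta_digit beta x (n : nat) : int :=
  Num.floor (beta * (iter n.-1 (beta_map beta) x)%:num).

(* A sum over a classical set; [beta_branch_bij] below shows that the set of
   preimages is finite, so the default value for infinite supports never
   intervenes. *)
Definition PF_fun beta (f : {i01 R} -> R[i]) : {i01 R} -> R[i] :=
  fun x => ((beta^-1)%:C)%C * \sum_(y \in [set y | beta_map beta y = x]) f y.

End BetaMap.

Section PerronFrobenius.
Context {R : realType} (beta : R) (hbeta : 1 < beta).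
Implicit Types (x y : {i01 R}) (f g : {i01 R} -> R[i]).

Let beta_gt0 : 0 < beta. Proof. exact: lt_trans hbeta. Qed.

Let beta_neq0 : beta != 0. Proof. by rewrite gt_eqF. Qed.

Let clip_ge0 (t : R) : 0 <= Num.max 0 (Num.min t 1).
Proof. by rewrite le_max lexx. Qed.

Let clip_le1 (t : R) : Num.max 0 (Num.min t 1) <= 1.
Proof. by rewrite ge_max ler01 ge_min lexx orbT. Qed.

(* The inverse branch y = (x + k) / beta of beta_map on y in [k / beta, (k + 1) / beta),
   clipped to [0, 1] in order to be total. *)
Definition beta_branch (k : nat) x : {i01 R} :=
  Itv01 (clip_ge0 ((x%:num + k%:R) / beta)) (clip_le1 ((x%:num + k%:R) / beta)).

Definition branch_dom (k : nat) : set {i01 R} :=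
  [set x | x%:num < 1 /\ x%:num + k%:R <= beta].

Definition nbranch : nat := (`|Num.floor beta|%N).+1.

Lemma beta_branchE k x : branch_dom k x -> (beta_branch k x)%:num = (x%:num + k%:R) / beta.
Proof.
move=> [x1 xk] /=; rewrite min_l; last by rewrite ler_pdivrMr// mul1r.
by rewrite max_r// divr_ge0// ltW.
Qed.

Lemma beta_branch_homo k : {homo beta_branch k : x y / (x <= y)%O}.
Proof.
move=> x y; rewrite -!num_le /= => xy.
rewrite ge_max le_max lexx/= le_max; apply/orP; right.
rewrite le_min !ge_min lexx orbT andbT.
by rewrite ler_pM2r ?invr_gt0// lerD2r xy.
Qed.

Lemma branch_dom_lower k x y : (x <= y)%O -> branch_dom k y -> branch_dom k x.
Proof.
rewrite -num_le /= => xy [y1 yk]; split; first exact: le_lt_trans y1.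
by apply: le_trans yk; rewrite lerD2r.
Qed.

Lemma beta_branch_bij x : set_bij (`I_nbranch `&` [set k | branch_dom k x])
  [set y | beta_map beta y = x] (beta_branch^~ x).
Proof.
split.
- move=> k [_ /= dk]; apply/val_inj => /=.
  have E := beta_branchE dk; rewrite /= in E; rewrite E mulrCA divff// mulr1.
  rewrite (@floor_def _ _ k%:Z); last first.
    case: dk => x1 _; apply/andP; split; first by rewrite lerDr.
    by rewrite intrD addrC ltrD2l.
  by rewrite addrK.
- move=> k l /set_mem[_ /= dk] /set_mem[_ /= dl] /(congr1 (fun z : {i01 R} => z%:num)).
  rewrite (beta_branchE dk) (beta_branchE dl) => /(mulIf (invr_neq0 beta_neq0))/addrI.
  by move=> /eqP; rewrite eqr_nat => /eqP.
- move=> y /= yx; pose k := `|Num.floor (beta * y%:num)|%N.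
  have by0 : 0 <= beta * y%:num by rewrite mulr_ge0// ltW.
  have kE : (Num.floor (beta * y%:num))%:~R = k%:R :> R.
    by rewrite /k -[RHS]/((_%:Z)%:~R) gez0_abs// floor_ge0.
  have xE : x%:num + k%:R = beta * y%:num by rewrite -yx /= kE subrK.
  have y1 : y%:num <= 1 by [].
  have dk : branch_dom k x.
    split; last by rewrite xE ger_pMr.
    by rewrite -yx /= ltrBlDl -(intrD R _ 1) floorD1_gt.
  exists k; last first.
    by apply/val_inj; rewrite -[LHS]/((beta_branch k x)%:num) (beta_branchE dk) xE mulrAC divff// mul1r.
split=> //=; rewrite /nbranch ltnS -lez_nat /k !gez0_abs ?floor_ge0 ?(ltW beta_gt0)//.
by apply: le_floor; rewrite ger_pMr.
Qed.

Lemma PF_funE f : PF_fun beta f =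
  ((beta^-1)%:C)%C *: \sum_(k < nbranch) (fun x => \1_(branch_dom k) x * f (beta_branch k x)).
Proof.
apply/funext => x; rewrite /PF_fun -[RHS]/(_ * _); congr (_ * _).
rewrite (reindex_fsbig _ _ _ _ (beta_branch_bij x)) fsbig_mkcondr -fsbig_ord fct_sumE.
apply: eq_bigr => k _; rewrite indicE.
have -> : (nat_of_ord k \in [set k | branch_dom k x]) = (x \in branch_dom k).
  by apply/idP/idP => /set_mem dk; exact: mem_set.
by case: (x \in branch_dom k); rewrite ?mul1r ?mul0r.
Qed.

Lemma PF_fun_bounded_variation f :
  bounded_variation01 f -> bounded_variation01 (PF_fun beta f).
Proof.
move=> bf; rewrite PF_funE; apply/bounded_variation01Z/asboolP.
rewrite -[X in is_true X]/(_ \in bv_pred); apply: rpred_sum => k _; apply/asboolP.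
apply/bounded_variation01P; exists (bv_norm f) => s.
exact: (variation01_lower_comp (@branch_dom_lower k) (@beta_branch_homo k) bf).
Qed.

Definition PF_BV (f : BV R) : BV R := mkBV (PF_fun_bounded_variation (BVP f)).

Lemma PF_BV_linear : linear PF_BV.
Proof.
move=> a f g; apply/val_inj => /=; rewrite !PF_funE.
rewrite scalerA [a * _]mulrC -scalerA -scalerDr; congr (_ *: _).
rewrite scaler_sumr -big_split/=; apply: eq_bigr => k _; apply/funext => x.
rewrite -[RHS]/(a * (_ * _) + (_ * _)) -[LHS]/(_ * (a * f _ + g _)).
by rewrite mulrDr mulrCA.
Qed.

HB.instance Definition _ := GRing.isLinear.Build R[i] (BV R) (BV R) _ PF_BV
  PF_BV_linear.

Lemma PF_BV_null (f : BV R) : f \in null_pred -> PF_BV f \in null_pred.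
Proof.
move=> /asboolP[A cA fA]; apply/asboolP; exists (beta_map beta @` A).
  by apply: sub_countable cA; exact: card_image_le.
move=> x xA; rewrite /= /PF_fun fsbig1 ?mulr0// => y /= yx.
by apply: fA => Ay; apply: xA; exists y.
Qed.

(* By [PF_toBVhat] the class does not depend on the representative. *)
Definition PF (u : BVhat R) : BVhat R := toBVhat (PF_BV (repr u)).

Lemma PF_toBVhat (f : BV R) : PF (toBVhat f) = toBVhat (PF_BV f).
Proof.
apply/toBVhat_eq; rewrite -linearB PF_BV_null//.
by apply/toBVhat_eq; exact: reprK.
Qed.

Lemma PF_linear : linear PF.
Proof.
move=> a u v; have [f <-] := toBVhat_surj u; have [g <-] := toBVhat_surj v.
by rewrite -linearP !PF_toBVhat !linearP.
Qed.

HB.instance Definition _ := GRing.isLinear.Build R[i] (BVhat R) (BVhat R) _ PF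
  PF_linear.

Lemma bv_norm_PF_BV (f : BV R) :
  bv_norm (PF_BV f) <= (beta^-1 * (nbranch%:R * 2)) * bv_norm f.
Proof.
have nb : normc ((beta^-1)%:C)%C = beta^-1.
  by rewrite normc_real ger0_norm// invr_ge0 ltW.
have sumE : nbranch%:R * bv_norm f = \sum_(k < nbranch) bv_norm f.
  by rewrite sumr_const card_ord mulr_natl.
have b1 s : sorted <=%O s ->
    variation01 (PF_BV f) s <= beta^-1 * (nbranch%:R * bv_norm f).
  move=> ss; rewrite /= PF_funE variation01Z nb ler_wpM2l ?invr_ge0 ?(ltW beta_gt0)//.
  rewrite sumE; elim/big_rec2: _ => [|k v h _ hv].
    by rewrite /variation01 big1// => j _; rewrite subrr normc0.
  apply: le_trans (variation01D _ _ _) _; rewrite lerD//.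
  exact: variation01_lower_comp (@branch_dom_lower k) (@beta_branch_homo k) (BVP f) ss.
have b2 x : normc (PF_BV f x) <= beta^-1 * (nbranch%:R * bv_norm f).
  rewrite /= PF_funE -[X in normc X]/(_ * _) normcM nb.
  rewrite ler_wpM2l ?invr_ge0 ?(ltW beta_gt0)//.
  rewrite sumE; elim/big_rec2: _ => [|k v h _ hv]; first by rewrite normc0.
  apply: le_trans (le_normc_add _ _) _; rewrite lerD// normcM indicE.
  apply: (@le_trans _ _ (normc (f (beta_branch k x)))).
    case: (x \in _); rewrite ?normc1 ?mul1r// normc0 mul0r; exact: normc_ge0.
  apply: le_trans (le_sup_norm _ (BVP f)) _.
  by rewrite lerDr total_variation01_ge0//; exact: BVP.
rewrite (_ : _ * _ * _ = beta^-1 * (nbranch%:R * bv_norm f)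
                       + beta^-1 * (nbranch%:R * bv_norm f)).
  by rewrite lerD//; [exact: total_variation01_le|exact: sup_norm_le].
by rewrite -!mulrA -mulrDr -mulrDr [2 * _]mulr_natl mulr2n.
Qed.

Lemma PF_bounded : bounded_op PF.
Proof.
pose C := beta^-1 * (nbranch%:R * 2).
exists ((C%:C)%C) => u; rewrite !norm_BVhatE -rmorphM lecR.
have C0 : 0 <= C by rewrite !mulr_ge0 ?invr_ge0 ?(ltW beta_gt0).
apply/ler_addgt0Pr => e e0.
have C1 : 0 < C + 1 by rewrite ltr_wpDl.
have [f <- fe] := quot_norm_adherent u (divr_gt0 e0 C1).
rewrite /= PF_toBVhat; apply: le_trans (quot_norm_le _) _.
apply: le_trans (bv_norm_PF_BV _) _.
apply: (le_trans (ler_wpM2l C0 (ltW fe))).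
rewrite mulrDr lerD2l mulrCA ger_pMr// ler_pdivrMr// mul1r.
by rewrite lerDl ler01.
Qed.

End PerronFrobenius.

Section Indicator.
Context {R : realType}.

Lemma bounded_variation01_indic (x : {i01 R}) :
  bounded_variation01 (\1_[set y | (y <= x)%O] : {i01 R} -> R[i]).
Proof. by apply: bounded_variation01_lower => y z yz /=; exact: le_trans. Qed.

(* The class of the indicator function of [0, x]. *)
Definition indic_BVhat (x : {i01 R}) : BVhat R :=
  toBVhat (mkBV (bounded_variation01_indic x)).

End Indicator.

(* Main.v *)
Require Import Defs.
From HB Require Import structures.
From mathcomp Require Import all_boot all_order all_algebra.
From mathcomp Require Import complex.
From mathcomp Require Import all_classical all_reals all_analysis.
From mathcomp Require Import ring.
Set Implicit Arguments.
Unset Strict Implicit.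
Unset Printing Implicit Defensive.
Import Order.TTheory GRing.Theory Num.Theory.
Import numFieldNormedType.Exports.
Import ComplexField.Normc.
Local Open Scope classical_set_scope.
Local Open Scope ring_scope.
Local Open Scope complex_scope.

(** Write L for the operator, [mu] for [beta * lambda], so that [1 < |mu|], and
tau for the beta-map.

The series.  The branches of tau lying left of [x] are [beta_digit beta x 1]
full ones followed by a piece of one branch that tau sends onto [[0, tau x]].
Hence, off the point 1,
[[
  L 1_[0,x] = beta^-1 * (a_1(x) * 1_[0,1] + 1_[0,tau x]),
]]
which is [PF_indic].  An eigenfunctional turns this into
[nu 1_[0,x] = (a_1(x) * nu 1_[0,1] + nu 1_[0,tau x]) / mu].  After [m]
iterations there appear the first [m] terms of the series and the remainder
[nu 1_[0,tau^m x] / mu ^ m], which is [O(|mu|^-m)] because all the indicators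
[1_[0,y]] have BV-norm at most 2.

The nonvanishing.  If [nu 1_[0,1] = 0], the formula shows that [nu] kills every
[1_[0,x]].  Step functions are not dense in BV, so this does not end the proof
by itself; it is the assumption [1 < |mu|] that does.  Let [b_k] be the inverse
branches of tau, the last of them extended past its domain by the constant 1,
and let [M f = beta^-1 * \sum_k (f \o b_k)].
- [L f] and [M f] differ, off one point, by a combination of indicators of
  initial intervals ([PF_toBVhat_clamped]), so [nu (L f) = nu (M f)].
- The ranges of the [b_k] follow one another in [[0, 1]], so that
  [var (M f) <= beta^-1 * var f] ([total_variation01_clamped_PF]).
- [|nu f| <= N * var f], since [nu] does not see the constants
  ([eigenfunctional_le_variation]).
Therefore [|nu f| = |lambda|^-n * |nu (M^n f)| <= N * |mu|^-n * var f] for all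
[n], so [nu = 0], contrary to its being an eigenfunctional. *)

(** * Geometric bounds *)

Section Geometric.
Context {R : realType}.

Lemma geometric_lt (C q e : R) : 0 <= q < 1 -> 0 < e ->
  \forall n \near \oo, C * q ^+ n < e.
Proof.
move=> /andP[q0 q1] e0.
have q1' : `|q| < 1 by rewrite ger0_norm.
exact: (cvgr_lt 0 (cvg_geometric C q1') e e0).
Qed.

Lemma normc_le_geometric_eq0 (C q : R) (z : R[i]) : 0 <= q < 1 ->
  (forall n, normc z <= C * q ^+ n) -> z = 0.
Proof.
move=> q01 zq; apply: eq0_normc; apply/eqP; rewrite eq_le normc_ge0 andbT.
apply/ler_addgt0Pr => e e0; rewrite add0r.
have [n _ /(_ _ (leqnn n)) /= nC] := geometric_lt C q01 e0.
exact: le_trans (zq n) (ltW nC).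
Qed.

Lemma cvg_normc_le_geometric (C q : R) (u : nat -> (R[i])^o) (l : (R[i])^o) :
  0 <= q < 1 -> (forall n, normc (l - u n) <= C * q ^+ n) ->
  u n @[n --> \oo] --> l.
Proof.
move=> q01 uq; apply/cvgrPdist_lt => e e0.
have eE : e = (complex.Re e)%:C by rewrite RRe_real ?gtr0_real.
have Re0 : 0 < complex.Re e by rewrite -ltcR -eE.
near=> n; rewrite [`|_|]norm_normc eE ltcR.
by apply: le_lt_trans (uq n) _; near: n; exact: geometric_lt.
Unshelve. all: by end_near. Qed.

End Geometric.

(** * Variation along partitions *)

Section Variation.
Context {R : realType}.
Implicit Types (f : {i01 R} -> R[i]) (s t : seq {i01 R}).

Lemma variation01_cons2 f x y s :
  variation01 f (x :: y :: s) = normc (f y - f x) + variation01 f (y :: s).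
Proof. by rewrite /variation01 /= big_nat_recl. Qed.

(** An inequality only: the step from the last point of [s] to the first point
of [t] counts on the right but not on the left. *)
Lemma variation01_cat f s t :
  variation01 f s + variation01 f t <= variation01 f (s ++ t).
Proof.
elim: s => [|x [|y s] IH]; first by rewrite {1}/variation01 big_geq// add0r.
  rewrite {1}/variation01 big_geq// add0r /=; case: t {IH} => [|y t].
    by rewrite /variation01 !big_geq.
  by rewrite variation01_cons2 lerDr normc_ge0.
by rewrite !cat_cons !variation01_cons2 -addrA lerD2l.
Qed.

Lemma variation01_sum n (F : 'I_n -> {i01 R} -> R[i]) s :
  variation01 (\sum_i F i) s <= \sum_i variation01 (F i) s.
Proof.
elim/big_rec2: _ => [|i v h _ hv].
  by rewrite /variation01 big1// => j _; rewrite subrr normc0.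
by apply: le_trans (variation01D _ _ _) _; rewrite lerD2l.
Qed.

End Variation.

(** * Points and classes *)

Section Points.
Context {R : realType}.
Implicit Types x : {i01 R}.

(** One exceptional point suffices below: the beta-map never takes the value 1,
so 1 is the only point where the branch formulas fail. *)
Lemma toBVhat_ext (f g : BV R) (z : {i01 R}) :
  (forall x, x != z -> f x = g x) -> toBVhat f = toBVhat g.
Proof.
move=> fg; apply/toBVhat_eq/asboolP; exists [set z]; first exact: countable1.
move=> x xz; rewrite -[LHS]/(f x - g x) fg ?subrr//.
by apply/eqP => /esym/esym.
Qed.

Lemma le_1i01 x : (x <= 1%:i01)%O.
Proof. by rewrite -num_le /=; have : x%:num <= 1 by []. Qed.

Lemma lt_1i01 x : x != 1%:i01 -> x%:num < 1.
Proof.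
move=> x1; rewrite lt_neqAle; apply/andP; split; last by [].
by apply: contra x1 => /eqP x1; apply/eqP/val_inj.
Qed.

End Points.

(** * The transfer operator modulo indicators *)

Section Clamped.
Context {R : realType} (beta : R) (hbeta : 1 < beta).
Implicit Types (x y : {i01 R}) (f : {i01 R} -> R[i]) (s t : seq {i01 R}).

Let beta_gt0 : 0 < beta. Proof. exact: lt_trans hbeta. Qed.

(** Clipping to [[0, 1]] is monotone, so it is enough that
[x + k <= k + 1 <= l <= y + l]. *)
Lemma beta_branch_lt k l x y : (k < l)%N ->
  (beta_branch beta k x <= beta_branch beta l y)%O.
Proof.
move=> kl; rewrite -num_le /= ge_max le_max lexx/= le_max; apply/orP; right.
rewrite le_min !ge_min lexx orbT andbT ler_pM2r ?invr_gt0//.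
have kl' : k%:R + 1 <= l%:R :> R by rewrite natr1 ler_nat.
have x1 : x%:num <= 1 by [].
have y0 : 0 <= y%:num by [].
apply/orP; left; apply: (le_trans (lerD x1 (lexx _))).
by rewrite addrC (le_trans kl')// lerDr.
Qed.

(** The images of [s] under the successive branches, put end to end, form one
sorted partition [t].  The middle clause, which keeps [t] below all later
branches, is what carries the induction. *)
Lemma sum_variation01_branch f n s : sorted <=%O s ->
  exists t, [/\ sorted <=%O t,
    forall z y, z \in t -> (z <= beta_branch beta n y)%O &
    \sum_(k < n) variation01 (f \o beta_branch beta k) s <= variation01 f t].
Proof.
move=> ss; elim: n => [|n [t [st tn tv]]].
  by exists [::]; split=> //; rewrite big_ord0 /variation01 big_geq.
exists (t ++ map (beta_branch beta n) s); split.
- rewrite (sorted_pairwise le_trans) pairwise_cat -!(sorted_pairwise le_trans) st /=.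
  apply/andP; split.
    by apply/allrelP => z _ zt /mapP[y _ ->]; exact: tn.
  rewrite sorted_map; apply: sub_sorted ss => x y; exact: beta_branch_homo.
- move=> z y; rewrite mem_cat => /orP[zt|/mapP[x _ ->]].
    by apply: le_trans (tn z y zt) _; exact: beta_branch_lt.
  exact: beta_branch_lt.
- rewrite big_ord_recr/=; apply: le_trans (variation01_cat _ _ _).
  by rewrite variation01_comp lerD2r.
Qed.

(** The Perron-Frobenius sum without the cut-offs at the ends of the branch
domains: these create jumps, which prevent the operator itself from contracting
the variation by the factor [beta^-1]. *)
Definition clamped_PF_fun f : {i01 R} -> R[i] :=
  (beta^-1)%:C *: \sum_(k < nbranch beta) (f \o beta_branch beta k).

Lemma variation01_clamped_PF f s : bounded_variation01 f -> sorted <=%O s ->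
  variation01 (clamped_PF_fun f) s <= beta^-1 * total_variation01 f.
Proof.
move=> bf ss; rewrite variation01Z normc_real ger0_norm ?invr_ge0 ?(ltW beta_gt0)//.
rewrite ler_pM2l ?invr_gt0//.
have [t [st _ tv]] := sum_variation01_branch f (nbranch beta) ss.
apply: le_trans (variation01_sum _ _) _; apply: le_trans tv _.
exact: le_total_variation01.
Qed.

Lemma clamped_PF_fun_bv f : bounded_variation01 f ->
  bounded_variation01 (clamped_PF_fun f).
Proof.
move=> bf; apply/bounded_variation01P; exists (beta^-1 * total_variation01 f).
by move=> s; exact: variation01_clamped_PF.
Qed.

Definition clamped_PF (f : BV R) : BV R := mkBV (clamped_PF_fun_bv (BVP f)).

Lemma total_variation01_clamped_PF (f : BV R) :
  total_variation01 (clamped_PF f) <= beta^-1 * total_variation01 f.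
Proof. by apply: total_variation01_le => s; exact: variation01_clamped_PF (BVP f). Qed.

Lemma beta_map_decomp x :
  beta * x%:num = (beta_map beta x)%:num + `|Num.floor (beta * x%:num)|%N%:R.
Proof.
have b0 : 0 <= beta * x%:num by rewrite mulr_ge0// ltW.
have -> : `|Num.floor (beta * x%:num)|%N%:R = (Num.floor (beta * x%:num))%:~R :> R.
  by rewrite -[LHS]/((_%:Z)%:~R) gez0_abs// floor_ge0.
by rewrite /= subrK.
Qed.

(** Off 1, all branches but the last are defined everywhere.  The last one is
defined on [[0, beta - floor beta]], whose right end is the image of 1, and it
is clipped to the value 1 beyond; so the difference between the two operators
is [beta^-1 * f 1] on the rest of the interval and 0 elsewhere. *)
Lemma PF_toBVhat_clamped (f : BV R) : PF hbeta (toBVhat f) =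
  toBVhat (clamped_PF f) - ((beta^-1)%:C * f 1%:i01) *:
     (indic_BVhat 1%:i01 - indic_BVhat (beta_map beta 1%:i01)).
Proof.
rewrite PF_toBVhat /indic_BVhat -[X in _ *: X]linearB -linearZ_LR -linearB.
apply: (toBVhat_ext (z := 1%:i01)) => x /lt_1i01 x1.
rewrite -[LHS]/(PF_fun beta f x) PF_funE//.
rewrite -[RHS]/(clamped_PF_fun f x - _ * f 1%:i01 * (\1_[set y | (y <= 1%:i01)%O] x
   - \1_[set y | (y <= beta_map beta 1%:i01)%O] x)).
rewrite /clamped_PF_fun -[LHS]/(_ * _) -[(_ *: _) x]/(_ * _) -mulrA -mulrBr.
congr (_ * _); rewrite !fct_sumE /nbranch !big_ord_recr/=.
set K := `|Num.floor beta|%N.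
have bE : beta = (beta_map beta 1%:i01)%:num + K%:R.
  have := beta_map_decomp (@Itv01 R 1 ler01 (lexx 1)).
  rewrite [X in beta * X](_ : _ = 1)// mulr1 => {1}->.
  by congr ((beta_map beta _)%:num + _); exact: val_inj.
rewrite -addrA; congr (_ + _).
  apply: eq_bigr => k _; rewrite indicE mem_set ?mul1r//; split=> //.
  have kK : k%:R + 1 <= K%:R :> R by rewrite natr1 ler_nat.
  rewrite bE addrC; apply: le_trans (_ : k%:R + 1 <= _).
    by rewrite lerD2l ltW.
  by rewrite (le_trans kK)// lerDr.
rewrite !indicE [_ \in [set y | (y <= 1%:i01)%O]](mem_set (le_1i01 x)).
have [xc|xc] := boolP (x <= beta_map beta 1%:i01)%O.
  rewrite [_ \in [set y | _]]mem_set// mem_set; last first.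
    by split=> //; rewrite [leRHS]bE lerD2r num_le.
  by rewrite subrr mulr0 subr0 mul1r.
rewrite [_ \in [set y | _]]memNset; last exact/negP.
rewrite memNset; last first.
  by move=> [_]; rewrite [leRHS]bE lerD2r num_le; exact/negP.
rewrite subr0 mulr1 mul0r (_ : beta_branch _ _ _ = 1%:i01) ?subrr//.
apply/val_inj => /=; rewrite min_r ?max_r//.
rewrite ler_pdivlMr// mul1r [leLHS]bE lerD2r num_le ltW// ltNge.
exact: xc.
Qed.

(** The branch point [(y + k) / beta] is at most [x] iff [y + k] is at most
[beta * x = a + tau x]; as [y] and [tau x] are both below 1, this means [k < a],
or [k = a] and [y <= tau x]. *)
Lemma PF_indic x : PF hbeta (indic_BVhat x) = (beta^-1)%:C *:
  ((beta_digit beta x 1)%:~R *: indic_BVhat 1%:i01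
     + indic_BVhat (beta_map beta x)).
Proof.
rewrite /indic_BVhat PF_toBVhat -[X in X + _]linearZ_LR -linearD -linearZ_LR.
apply: (toBVhat_ext (z := 1%:i01)) => y /lt_1i01 y1.
rewrite -[LHS]/(PF_fun beta _ y) PF_funE//.
rewrite -[RHS]/(_ * (_ * (\1_[set y | (y <= 1%:i01)%O] y)
   + \1_[set y | (y <= beta_map beta x)%O] y)) -[LHS]/(_ * _).
congr (_ * _); rewrite !fct_sumE.
rewrite !indicE [_ \in [set y | (y <= 1%:i01)%O]](mem_set (le_1i01 y)) mulr1.
have xE := beta_map_decomp x.
set a := `|_|%N in xE.
have -> : (beta_digit beta x 1)%:~R = a%:R :> R[i].
  rewrite -[RHS]/((a%:Z)%:~R) /a gez0_abs// floor_ge0 mulr_ge0//; exact: ltW.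
have ab : (a < nbranch beta)%N.
  rewrite /nbranch ltnS -lez_nat /a !gez0_abs ?floor_ge0 ?(ltW beta_gt0)//.
    by apply: le_floor; rewrite ger_pMr.
  by rewrite mulr_ge0// ltW.
have tau1 : (beta_map beta x)%:num < 1.
  by rewrite /= ltrBlDl -(intrD R _ 1) floorD1_gt.
pose t : R[i] := (y \in [set y | (y <= beta_map beta x)%O])%:R.
rewrite -/t.
transitivity (\sum_(k < nbranch beta) ((k < a)%N%:R + (k == a :> nat)%:R * t)).
  apply: eq_bigr => k _; rewrite !indicE.
  (* The domain condition is implied by the inequality on the right, since
     [beta * x <= beta]. *)
  have dkx : (branch_dom beta k y /\ (beta_branch beta k y <= x)%O) <->
      y%:num + k%:R <= (beta_map beta x)%:num + a%:R.
    split=> [[dk]|le].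
      by rewrite -num_le (beta_branchE hbeta dk) ler_pdivrMr// mulrC xE.
    have dk : branch_dom beta k y.
      by split=> //; apply: (le_trans le); rewrite -xE ger_pMr.
    by split=> //; rewrite -num_le (beta_branchE hbeta dk) ler_pdivrMr// mulrC xE.
  have -> : ((y \in branch_dom beta k)%:R * (beta_branch beta k y \in
     [set y0 | (y0 <= x)%O])%:R : R[i]) =
     (y%:num + k%:R <= (beta_map beta x)%:num + a%:R)%R%:R.
    rewrite -natrM mulnb; congr (nat_of_bool _)%:R.
    apply/andP/idP => [[/set_mem d /set_mem b]|/dkx[d b]]; first exact/dkx.
    by split; exact: mem_set.
  have t0 : 0 <= (beta_map beta x)%:num by [].
  have y0 : 0 <= y%:num by [].
  case: (ltngtP k a) => ka; rewrite ?mul0r ?mul1r ?addr0 ?add0r.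
  - have ka' : k%:R + 1 <= a%:R :> R by rewrite natr1 ler_nat.
    suff -> : y%:num + k%:R <= (beta_map beta x)%:num + a%:R by [].
    rewrite addrC; apply: le_trans (_ : k%:R + 1 <= _).
      by rewrite lerD2l ltW.
    by rewrite (le_trans ka')// lerDr.
  - have ka' : a%:R + 1 <= k%:R :> R by rewrite natr1 ler_nat.
    suff : (beta_map beta x)%:num + a%:R < y%:num + k%:R.
      by rewrite ltNge => /negbTE->.
    rewrite addrC; apply: (@lt_le_trans _ _ (a%:R + 1)).
      by rewrite ltrD2l.
    by rewrite (le_trans ka')// lerDr.
  - rewrite ka lerD2r num_le /t; congr (nat_of_bool _)%:R.
    by apply/idP/idP => [/mem_set|/set_mem].
rewrite big_split/= -mulr_suml; congr (_ + _).
  rewrite -natr_sum; congr _%:R.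
  rewrite -(big_mkord xpredT (fun k => (k < a)%N : nat)) (big_cat_nat (n := a))//=;
    last exact: ltnW.
  rewrite (eq_big_nat _ _ (F2 := fun=> 1%N)); last by move=> k /andP[_ ->].
  rewrite sum_nat_const_nat subn0 muln1 big_nat_cond big1 ?addn0// => k.
  by rewrite andbT => /andP[ak _]; rewrite ltnNge ak.
rewrite (bigD1 (Ordinal ab))//= eqxx big1 ?addr0 ?mul1r// => k.
by rewrite -val_eqE /= => /negbTE ->.
Qed.

End Clamped.

(** * Eigenfunctionals *)

Section Eigenfunctional.
Context {R : realType} (beta : R) (hbeta : 1 < beta).
Context (lambda : R[i]) (nu : {linear BVhat R -> (R[i])^o}).
Context (lambda_big : (beta^-1)%:C < `|lambda|)
  (nu_eigen : eigenfunctional (PF hbeta) lambda nu).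
Implicit Types (x : {i01 R}) (f : BV R).

Let beta_gt0 : 0 < beta. Proof. exact: lt_trans hbeta. Qed.

Let mu : R[i] := beta%:C * lambda.
Let q : R := (normc mu)^-1.

Let nu_PF (u : BVhat R) : nu (PF hbeta u) = lambda * nu u.
Proof. by case: nu_eigen => _ _ /(_ u). Qed.

Let normc_mu_gt1 : 1 < normc mu.
Proof.
rewrite normcM normc_real gtr0_norm//.
by rewrite -ltr_pdivrMl// mulr1 -ltcR -norm_normc.
Qed.

Let mu_neq0 : mu != 0.
Proof.
by apply: contraTneq normc_mu_gt1 => ->; rewrite normc0 -leNgt ler01.
Qed.

Let beta_neq0 : beta%:C != 0 :> R[i].
Proof. by apply: contraNneq mu_neq0 => b0; rewrite /mu b0 mul0r. Qed.

Let lambda_neq0 : lambda != 0.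
Proof. by apply: contraNneq mu_neq0 => l0; rewrite /mu l0 mulr0. Qed.

Lemma ratio_ge0_lt1 : 0 <= q < 1.
Proof. by rewrite /q invr_ge0 normc_ge0 invf_lt1// (lt_trans _ normc_mu_gt1). Qed.

Let normc_mu_expV n : normc (mu ^- n) = q ^+ n.
Proof.
rewrite -exprVn; elim: n => [|n IH]; first by rewrite !expr0 normc1.
by rewrite !exprS normcM IH normcV.
Qed.

(** Boundedness in [BVhat] is stated with a complex constant; this real form in
terms of representatives is the one that the estimates use. *)
Lemma bounded_functional : exists2 N : R, 0 <= N &
  forall f, normc (nu (toBVhat f)) <= N * bv_norm f.
Proof.
case: nu_eigen => [[M nuM] _ _]; exists (normc M) => [|f]; first exact: normc_ge0.
apply: le_trans (ler_wpM2l (normc_ge0 M) (quot_norm_le f)).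
rewrite -lecR rmorphM -[leLHS]norm_normc.
apply: le_trans (nuM _) _.
rewrite -[leRHS]/(`|M| * `|toBVhat f|) -[X in _ <= _ * X]normr_id -normrM ger0_norm//.
exact: le_trans (normr_ge0 _) (nuM _).
Qed.

Lemma eigenfunctional_indic_step x : nu (indic_BVhat x) =
  (nu (indic_BVhat 1%:i01) * (beta_digit beta x 1)%:~R
     + nu (indic_BVhat (beta_map beta x))) / mu.
Proof.
apply: (mulIf mu_neq0); rewrite divfK// mulrC /mu -mulrA -nu_PF PF_indic.
rewrite linearZ linearD linearZ /= mulrA fmorphV mulfV// mul1r.
by rewrite [X in _ = X + _]mulrC.
Qed.

Lemma eigenfunctional_indic_expansion x m : nu (indic_BVhat x) =
  nu (indic_BVhat 1%:i01) * (\sum_(1 <= n < m.+1)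
    (beta_digit beta x n)%:~R / (beta%:C ^+ n * lambda ^+ n))
  + nu (indic_BVhat (iter m (beta_map beta) x)) / mu ^+ m.
Proof.
elim: m => [|m IH]; first by rewrite big_geq// mulr0 add0r expr0 divr1.
rewrite big_nat_recr//= {1}IH mulrDr -addrA; congr (_ + _).
rewrite [in LHS]eigenfunctional_indic_step -exprMn -/mu.
by rewrite exprS [(_ * mu ^+ m)^-1]invfM; ring.
Qed.

Lemma eigenfunctional_indic_tail : exists C : R, forall x m,
  normc (nu (indic_BVhat x) - nu (indic_BVhat 1%:i01) * (\sum_(1 <= n < m.+1)
    (beta_digit beta x n)%:~R / (beta%:C ^+ n * lambda ^+ n))) <= C * q ^+ m.
Proof.
have [N N0 nuN] := bounded_functional; exists (N * 2) => x m.
rewrite {1}(eigenfunctional_indic_expansion x m) addrC addKr normcM normc_mu_expV.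
rewrite ler_wpM2r ?exprn_ge0//; first by case/andP: ratio_ge0_lt1.
apply: le_trans (nuN _) _; rewrite ler_wpM2l//.
(* Variation and sup norm of an indicator are each at most 1. *)
rewrite [2]/(1 + 1) lerD//.
  apply: total_variation01_le => s; apply: variation01_lower => y z yz /=.
  exact: le_trans.
by apply: sup_norm_le => y /=; rewrite indicE; case: (_ \in _); rewrite ?normc1 ?normc0.
Qed.

Section Vanishing.
Context (nu1 : nu (indic_BVhat 1%:i01) = 0).

Lemma eigenfunctional_indic_eq0 x : nu (indic_BVhat x) = 0.
Proof.
have [C nuC] := eigenfunctional_indic_tail.
apply: (normc_le_geometric_eq0 (C := C) ratio_ge0_lt1) => m.
by have := nuC x m; rewrite nu1 mul0r subr0.
Qed.

Lemma eigenfunctional_clamped f :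
  nu (toBVhat f) = lambda^-1 * nu (toBVhat (clamped_PF hbeta f)).
Proof.
apply: (mulfI lambda_neq0); rewrite mulVKf// -nu_PF PF_toBVhat_clamped linearB.
by rewrite linearZ linearB /= !eigenfunctional_indic_eq0 subrr scaler0 subr0.
Qed.

(** Subtracting the constant [f 0] leaves [nu f] and the variation unchanged and
makes the sup norm at most the variation. *)
Lemma eigenfunctional_le_variation : exists2 N : R, 0 <= N &
  forall f, normc (nu (toBVhat f)) <= N * total_variation01 f.
Proof.
have [N N0 nuN] := bounded_functional; exists (N * 2) => [|f]; first by rewrite mulr_ge0.
have [c cE nuc] : exists2 c : BV R,
    forall x, c x = f 0%:i01 & nu (toBVhat c) = 0.
  exists (f 0%:i01 *: mkBV (bounded_variation01_indic 1%:i01)) => [x|].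
    rewrite -[LHS]/(_ * \1_[set y | (y <= 1%:i01)%O] x) indicE mem_set ?mulr1//=.
    exact: le_1i01.
  rewrite linearZ linearZ /= -/(indic_BVhat _).
  by rewrite eigenfunctional_indic_eq0 scaler0.
have -> : nu (toBVhat f) = nu (toBVhat (f - c)).
  by rewrite linearB linearB /= nuc subr0.
apply: le_trans (nuN _) _; rewrite -mulrA ler_wpM2l// mulr_natl mulr2n lerD//.
  apply: total_variation01_le => s ss.
  apply: le_trans (le_total_variation01 (BVP f) ss).
  apply: ler_sum => j _; rewrite -[X in normc X <= _]/(f _ - c _ - (f _ - c _)).
  by rewrite !cE opprB addrA subrK.
apply: sup_norm_le => x; rewrite -[X in normc X]/(f x - c x) cE.
have ss : sorted <=%O [:: 0%:i01; x] by rewrite /= andbT -num_le; apply: ge0.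
by have := le_total_variation01 (BVP f) ss; rewrite /variation01 /= big_nat1.
Qed.

(** Each application of the clamped operator gains the factor
[|lambda|^-1 * beta^-1 < 1]. *)
Lemma eigenfunctional_eq0 f : nu (toBVhat f) = 0.
Proof.
have [N N0 nuN] := eigenfunctional_le_variation.
apply: (normc_le_geometric_eq0 (C := N * total_variation01 f) ratio_ge0_lt1) => n.
elim: n f => [|n IH] f; first by rewrite expr0 mulr1.
rewrite eigenfunctional_clamped normcM.
have l0 : 0 <= normc lambda^-1 by exact: normc_ge0.
apply: le_trans (ler_wpM2l l0 (IH _)) _.
have V := total_variation01_clamped_PF hbeta f.
have q0 : 0 <= q ^+ n by apply: exprn_ge0; case/andP: ratio_ge0_lt1.
apply: le_trans (ler_wpM2l l0 (ler_wpM2r q0 (ler_wpM2l N0 V))) _.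
rewrite [leRHS](_ : _ = normc lambda^-1 * (N * (beta^-1 * total_variation01 f) * q ^+ n))//.
rewrite exprS {1}/q /mu normcM invfM normc_real gtr0_norm// normcV.
ring.
Qed.

End Vanishing.

Lemma eigenfunctional_indic1_neq0 : nu (indic_BVhat 1%:i01) != 0.
Proof.
apply/eqP => nu1; case: nu_eigen => _ [u + _].
by have [f <-] := toBVhat_surj u; rewrite (eigenfunctional_eq0 nu1) eqxx.
Qed.

End Eigenfunctional.

Theorem proposition4p2 (R : realType) (beta : R) (hbeta : 1 < beta)
    (lambda : R[i]) (nu : {linear BVhat R -> (R[i])^o}) :
  isolated_eigenvalue (PF hbeta) lambda ->
  (beta^-1)%:C < `|lambda| ->
  eigenfunctional (PF hbeta) lambda nu ->
  (forall x : {i01 R},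
     let S := (fun m => \sum_(1 <= n < m)
       (beta_digit beta x n)%:~R / (beta%:C ^+ n * lambda ^+ n))
       : nat -> (R[i])^o in
     cvgn S /\
     nu (indic_BVhat x) = nu (indic_BVhat 1%:i01) * limn S) /\
  nu (indic_BVhat 1%:i01) != 0.
Proof.
move=> _ lambda_big nu_eigen.
have nu1 := eigenfunctional_indic1_neq0 lambda_big nu_eigen.
have [C nuC] := eigenfunctional_indic_tail lambda_big nu_eigen.
split=> // x S; move: nu1 nuC.
set n1 := nu (indic_BVhat (widen_itv _)) => nu1 nuC.
(* The sum over [1 <= n < m.+1] is the one that the tail estimate bounds, hence
   the shift by one. *)
have cS : S m @[m --> \oo] --> (nu (indic_BVhat x) / n1 : (R[i])^o).
  rewrite -cvg_shiftS.
  apply: (cvg_normc_le_geometric (C := normc n1^-1 * C)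
    (ratio_ge0_lt1 hbeta lambda_big)) => m.
  rewrite -mulrA; apply: le_trans (ler_wpM2l (normc_ge0 _) (nuC x m)).
  by rewrite -normcM mulrBr mulrC mulKf.
split; first by apply/cvg_ex; eexists; exact: cS.
by rewrite (cvg_lim (@norm_hausdorff _ _) cS) mulrC divfK.
Qed.
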